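(* Let $D$ be a squarefree integer with $D \equiv 1 \pmod 4$ such that $K = \mathbb{Q}(\sqrt{D})$ is a quadratic number field (i.e. $D \neq 1$). Then the planar lattice $\Omega_K = \Sigma_K(\mathcal{O}_K)$ is not an equal covering extension of any rank-one lattice.
   Context: For the quadratic number field $K = \mathbb{Q}(\sqrt{D})$ with embeddings $\sigma_1, \sigma_2 : K \to \mathbb{C}$ (here $\sigma_1$ is the one sending $\sqrt{D}$ to $\sqrt{D}$, respectively to $i\sqrt{|D|}$ if $D<0$), the Minkowski embedding $\Sigma_K : K \to \mathbb{R}^2$ is defined by $\Sigma_K(x) = (\sigma_1(x), \sigma_2(x))^\top$ if $D > 0$, and $\Sigma_K(x) = (\Re(\sigma_1(x)), \Im(\sigma_1(x)))^\top$ if $D < 0$. $\mathcal{O}_K$ is the ring of integers of $K$ and $\Omega_K := \Sigma_K(\mathcal{O}_K)$. The covering radius of a lattice is $\mu(\Lambda) = \min\{ r \in \mathbb{R} : \Lambda + B(r) = \operatorname{span}_{\mathbb{R}}\Lambda\}$, where $B(r)$ is the closed ball of radius $r$ centered at the origin in $\operatorname{span}_{\mathbb{R}}\Lambda$. If $L \subset \Lambda$ is a sublattice of smaller rank, $\Lambda$ is an equal covering extension of $L$ if $\Lambda \cap \operatorname{span}_{\mathbb{R}} L = L$ and $\mu(\Lambda) = \mu(L)$. *)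

(* Defs.v *)
From HB Require Import structures.
From mathcomp Require Import all_boot all_order all_algebra all_field.
From mathcomp Require Import boolp classical_sets reals.
From mathcomp Require Export complex.
Set Implicit Arguments.
Unset Strict Implicit.
Unset Printing Implicit Defensive.
Import Order.TTheory GRing.Theory Num.Theory.
Local Open Scope classical_set_scope.
Local Open Scope ring_scope.
Local Open Scope complex_scope.

(* Excludes 0, which is divisible by 2 ^+ 2. *)
Definition squarefree_int (D : int) : Prop :=
  forall d : int, (d ^+ 2 %| D)%Z -> d \is a GRing.unit.

Section Lattices.
Variables (R : realType) (n : nat).
Implicit Types (L Lambda A : set 'cV[R]_n).

(* Euclidean; the norm that MathComp-Analysis puts on matrices is the
   maximum norm. *)
Definition enorm (x : 'cV[R]_n) : R := Num.sqrt (\sum_i x i 0 ^+ 2).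

Definition rspan A : set 'cV[R]_n :=
  [set x | exists (m : nat) (v : 'I_m -> 'cV[R]_n) (c : 'I_m -> R),
             (forall i, A (v i)) /\ x = \sum_i c i *: v i].

Definition is_lattice_of_rank (k : nat) Lambda : Prop :=
  exists B : 'M[R]_(n, k),
    \rank B = k /\
    Lambda = [set B *m map_mx intr z | z in [set: 'cV[int]_k]].

Definition span_ball Lambda (r : R) : set 'cV[R]_n :=
  [set y | rspan Lambda y /\ enorm y <= r].

Definition covering_radii Lambda : set R :=
  [set r | [set x + y | x in Lambda & y in span_ball Lambda r]
           = rspan Lambda].

(* The minimum of the covering radii. The default value 0 of xget is never
   used for a lattice, for which the minimum is attained. *)
Definition covering_radius Lambda : R :=
  xget 0 (covering_radii Lambda `&` lbound (covering_radii Lambda)).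

Definition equal_covering_extension L Lambda : Prop :=
  (exists k m : nat,
     [/\ is_lattice_of_rank k L, is_lattice_of_rank m Lambda & (k < m)%N]) /\
  [/\ L `<=` Lambda,
      Lambda `&` rspan L = L &
      covering_radius Lambda = covering_radius L].

End Lattices.

Section QuadraticFields.
Variable R : realType.

(* The root of D in C with nonnegative real and imaginary parts. *)
Definition csqrtz (D : int) : R[i] :=
  if 0 < D then (Num.sqrt D%:~R)%:C else 'i * (Num.sqrt `|D|%:~R)%:C.

(* K = Q(s), where s is a square root of D. *)
Definition is_Qsqrt (D : int) (K : fieldExtType rat) (s : K) : Prop :=
  s ^+ 2 = D%:~R /\ <<1%VS; s>>%VS = fullv.

Variable K : fieldExtType rat.

Definition integers_of : set K := [set x | integralOver (intr : int -> K) x].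

(* For D > 0 the values of both embeddings are real, so that taking real parts
   only changes their type from R[i] to R. *)
Definition minkowski (D : int) (sigma1 sigma2 : K -> R[i]) (x : K) :
    'cV[R]_2 :=
  if 0 < D then
    \col_(i < 2) (if i == 0 then complex.Re (sigma1 x)
                  else complex.Re (sigma2 x))
  else
    \col_(i < 2) (if i == 0 then complex.Re (sigma1 x)
                  else complex.Im (sigma1 x)).

Definition Omega (D : int) (sigma1 sigma2 : K -> R[i]) : set 'cV[R]_2 :=
  [set minkowski D sigma1 sigma2 x | x in integers_of].

End QuadraticFields.

(* Main.v *)
Require Import Defs.
From HB Require Import structures.
From mathcomp Require Import all_boot all_order all_algebra all_field.
From mathcomp Require Import boolp classical_sets reals.
From mathcomp Require Import zify ring lra.
Set Implicit Arguments.
Unset Strict Implicit.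
Unset Printing Implicit Defensive.
Import Order.TTheory GRing.Theory Num.Theory.
Local Open Scope classical_set_scope.
Local Open Scope ring_scope.
Local Open Scope complex_scope.

(** Write d for the absolute value of D. Since D = 1 mod 4 is squarefree, the
    ring of integers is Z + Z omega with omega = (1 + sqrt D) / 2, and the
    squared length of the Minkowski image of m + n omega is
    kappa ((m + n / 2) ^ 2 + d n ^ 2 / 4), with kappa = 2 for D > 0 and
    kappa = 1 for D < 0. In both cases the lattice is therefore, up to
    similarity, the centered rectangular lattice generated by (1, 0) and
    (1 / 2, sqrt d / 2), and its covering radius is explicit: as d >= 1, the
    triangle on these two generators has no obtuse angle, so the covering
    radius is its circumradius (d + 1) / (4 sqrt d), times sqrt kappa
    (lemma [covering_radius_centered]).

    A rank-one lattice Z b has covering radius |b| / 2. If it shared its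
    covering radius with a lattice as above containing b = m + n omega, then
    kappa would cancel and
      (2 m + n) ^ 2 + d n ^ 2 = (d + 1) ^ 2 / d,
    whose left-hand side is an integer. Hence d divides (d + 1) ^ 2, so d
    divides 1, whereas D <> 1 and D = 1 mod 4 force d >= 3
    (lemma [centered_form_neq_hole]). *)

(** * Lattices given by a basis and their covering radius *)

Lemma sum_ord2 (V : nmodType) (F : 'I_2 -> V) : \sum_i F i = F 0 + F 1.
Proof.
rewrite big_ord_recl big_ord1; congr (F _ + F _); exact/val_inj.
Qed.

Section LatticeFromBasis.
Variables (R : realType) (n k : nat).
Implicit Types (B : 'M[R]_(n, k)) (w : 'cV[R]_k) (z : 'cV[int]_k).

Definition lattice_of B : set 'cV[R]_n :=
  [set B *m map_mx intr z | z in [set: 'cV[int]_k]].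

Lemma rspan_lattice_of B : rspan (lattice_of B) = range (mulmx B).
Proof.
apply/seteqP; split => [x [m [v [c [vP ->]]]]|x [w _ <-]].
  have /choice[z zP] : forall i, exists z, B *m map_mx intr z = v i.
    by move=> i; have [z _ <-] := vP i; exists z.
  exists (\sum_i c i *: map_mx intr (z i)) => //.
  by rewrite mulmx_sumr; apply: eq_bigr => i _; rewrite -scalemxAr zP.
exists k, (fun j => col j B), (fun j => w j 0); split => [j|].
  exists (delta_mx j 0) => //; rewrite colE; congr (_ *m _).
  by apply/matrixP => a b; rewrite !mxE; case: (_ && _).
apply/colP => i; rewrite mxE summxE; apply: eq_bigr => j _.
by rewrite !mxE mulrC.
Qed.

(** The first condition makes [r] a covering radius, and the deep hole of the
    second one makes it a lower bound of all of them. Points of the span are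
    given by their coordinates in the basis, so that both conditions concern
    distances between coordinate vectors and integer vectors. *)
Lemma covering_radius_lattice_of B (r : R) :
    (forall w, exists z, enorm (B *m (w - map_mx intr z)) <= r) ->
    (exists w, forall z, r <= enorm (B *m (w - map_mx intr z))) ->
  covering_radius (lattice_of B) = r.
Proof.
move=> covers [hole holeP].
have lower : lbound (covering_radii (lattice_of B)) r.
  move=> t /seteqP[_ /(_ (B *m hole))].
  rewrite rspan_lattice_of => /(_ (ex_intro2 _ _ hole I erefl)).
  move=> [_ [z _ <-] [y [_ yt] zy]]; apply: le_trans (holeP z) _.
  by rewrite mulmxBr -zy addrC addKr.
have inradii : covering_radii (lattice_of B) r.
  rewrite /covering_radii /span_ball /= rspan_lattice_of.
  apply/seteqP; split => [_ [_ [z _ <-] [_ [[w _ <-] _] <-]]|_ [w _ <-]].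
    by exists (map_mx intr z + w) => //; rewrite mulmxDr.
  have [z zw] := covers w.
  exists (B *m map_mx intr z); first by exists z.
  exists (B *m (w - map_mx intr z)); last by rewrite -mulmxDr addrC subrK.
  by split => //; exists (w - map_mx intr z).
apply: xget_unique => // t [tin tlow].
by apply/eqP; rewrite eq_le (tlow _ inradii) (lower _ tin).
Qed.

End LatticeFromBasis.

Lemma enormZ (R : realType) n (a : R) (v : 'cV[R]_n) :
  enorm (a *: v) = `|a| * enorm v.
Proof.
rewrite /enorm -sqrtr_sqr -sqrtrM ?sqr_ge0 // mulr_sumr; congr Num.sqrt.
by apply: eq_bigr => i _; rewrite mxE exprMn.
Qed.

(** In the coordinate along [b], the deep hole is 1/2, and rounding to the
    nearest integer shows that no point does worse. *)
Lemma covering_radius_rank1 (R : realType) n (b : 'cV[R]_n) :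
  covering_radius (lattice_of b) = enorm b / 2.
Proof.
have normE (w z : 'cV[_]_1) :
    enorm (b *m (w - map_mx intr z)) = `|w 0 0 - (z 0 0)%:~R| * enorm b.
  by rewrite [w - _]mx11_scalar mul_mx_scalar enormZ !mxE.
rewrite mulrC; apply: covering_radius_lattice_of => [w|].
  exists (const_mx (Num.floor (w 0 0 + 2^-1))); rewrite normE mxE.
  rewrite ler_wpM2r ?sqrtr_ge0 // ler_norml.
  have := floor_le (w 0 0 + 2^-1); have := floorD1_gt (w 0 0 + 2^-1).
  by rewrite intrD; lra.
exists (const_mx 2^-1) => z; rewrite normE mxE ler_wpM2r ?sqrtr_ge0 //.
rewrite ler_normr; have [z0|z1] := lerP (z 0 0) 0.
  by have := z0; rewrite -(lerz0 R); lra.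
by move: z1; rewrite gtz0_ge1 -(ler1z R); lra.
Qed.

(** * The centered rectangular lattice *)

(** Squared length of the point with coordinates [x], [y] in the basis (1, 0),
    (1 / 2, sqrt d / 2) of the Euclidean plane. *)
Definition centered_form (R : realType) (d x y : R) : R :=
  (x + y / 2) ^+ 2 + d * y ^+ 2 / 4.

(** The lattice consists of the rectangles of size 1 by sqrt d and of their
    centers. Translations and a reflection bring any point into a quarter of
    such a rectangle, of which two opposite corners are lattice points. Cut this
    quarter along the perpendicular bisector of the two corners: on each half
    the squared distance to the corner on its side is bounded by its value at
    the points where the bisector meets the lines through the two sides of
    length sqrt d / 2, which is (d + 1) ^ 2 / (16 d). *)
Lemma centered_form_covers (R : realType) (d x y : R) : 0 < d ->
  exists m n : int,
    centered_form d (x - m%:~R) (y - n%:~R) <= (d + 1) ^+ 2 / (16 * d).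
Proof.
move=> d0.
(* [u] is the distance along the side 1 and [v] is the fraction of the side
   sqrt d; the third hypothesis says that (u, v) is at least as close to the
   corner (0, 0) as to the opposite corner of the quarter. *)
have half (u v : R) : 0 <= u <= 2^-1 -> 0 <= v -> 4 * u + 2 * d * v <= d + 1 ->
    u ^+ 2 + d * v ^+ 2 / 4 <= (d + 1) ^+ 2 / (16 * d).
  move=> /andP[u0 u1] v0 near; rewrite ler_pdivlMr; last by lra.
  have dv : (2 * d * v) ^+ 2 <= (d + 1 - 4 * u) ^+ 2.
    have dv0 : 0 <= 2 * d * v by rewrite !mulr_ge0 // ltW.
    by rewrite ler_sqr ?nnegrE //; lra.
  (* Once [v] has been eliminated, this quantity is what separates the two
     sides; it vanishes exactly for u = 0 and u = 1/2. *)
  have : 0 <= (d + 1) * (u * (2^-1 - u)).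
    by rewrite !mulr_ge0 //; lra.
  by move: dv; lra.
have rect (u v : R) : 0 <= u <= 2^-1 -> 0 <= v <= 1 ->
    u ^+ 2 + d * v ^+ 2 / 4 <= (d + 1) ^+ 2 / (16 * d) \/
    (2^-1 - u) ^+ 2 + d * (1 - v) ^+ 2 / 4 <= (d + 1) ^+ 2 / (16 * d).
  move=> u01 v01; have [near|far] := lerP (4 * u + 2 * d * v) (d + 1).
    by left; apply: half => //; lra.
  by right; apply: half; lra.
pose n := Num.floor y; pose v := y - n%:~R.
have v01 : 0 <= v <= 1.
  have := floor_le y; have := floorD1_gt y.
  by rewrite intrD /v /n; lra.
pose X := x + (y - n%:~R) / 2; pose m := Num.floor (X + 2^-1).
pose t := X - m%:~R.
have t01 : - 2^-1 <= t <= 2^-1.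
  have := floor_le (X + 2^-1); have := floorD1_gt (X + 2^-1).
  by rewrite intrD /t /m; lra.
(* The reflection t |-> - t exchanges the two centers that are closest to the
   line t = 0, hence the shift of [m] when t < 0. *)
have [t0|t0] := lerP 0 t.
  have u01 : 0 <= t <= 2^-1 by lra.
  have [le|le] := rect _ _ u01 v01; [exists m, n|exists m, (n + 1)];
    apply: le_trans le; rewrite /centered_form le_eqVlt; apply/orP; left;
    apply/eqP;
    by rewrite ?intrD /t /X /v; field.
have u01 : 0 <= - t <= 2^-1 by lra.
have [le|le] := rect _ _ u01 v01; [exists m, n|exists (m - 1), (n + 1)];
  apply: le_trans le; rewrite /centered_form le_eqVlt; apply/orP; left;
  apply/eqP;
  by rewrite ?intrD ?intrB /t /X /v; field.
Qed.

(** The deep hole is the circumcenter of 0, (1, 0) and (1 / 2, sqrt d / 2). For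
    the lattice point with coordinates [m], [n] and k = 2 m + n - 1, the excess
    of its squared distance to the circumcenter over the squared circumradius is
    a quarter of k ^ 2 + n ^ 2 - 1 + (d - 1) n (n - 1). This is nonnegative
    for d >= 1, because [k] and [n] have opposite parities, so that they are not
    both 0. *)
Lemma centered_form_hole (R : realType) (d : R) : 1 <= d ->
  exists x y : R, forall m n : int,
    (d + 1) ^+ 2 / (16 * d) <= centered_form d (x - m%:~R) (y - n%:~R).
Proof.
move=> d1; have d0 : d != 0 by rewrite gt_eqF //; lra.
pose y := (d - 1) / (2 * d).
exists (2^-1 - y / 2), y => m n; rewrite -subr_ge0.
pose k := 2 * m + n - 1.
have -> : centered_form d (2^-1 - y / 2 - m%:~R) (y - n%:~R)
            - (d + 1) ^+ 2 / (16 * d)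
  = ((k ^+ 2 + n ^+ 2 - 1)%:~R + (d - 1) * (n * (n - 1))%:~R) / 4.
  by rewrite /k /centered_form /y; field.
have kn : 0 <= k ^+ 2 + n ^+ 2 - 1.
  have sqr_ge1 (a : int) : a != 0 -> 1 <= a ^+ 2.
    by move=> a0; rewrite -gtz0_ge1 exprn_even_gt0.
  rewrite subr_ge0; have [n0|/sqr_ge1 n1] := eqVneq n 0.
    by rewrite ler_wpDr ?sqr_ge0 // sqr_ge1 // /k; lia.
  by rewrite ler_wpDl ?sqr_ge0.
have nn : 0 <= n * (n - 1) by nia.
by rewrite divr_ge0 // addr_ge0 ?mulr_ge0 ?ler0z //; lra.
Qed.

(** Both signatures of the quadratic field are covered by the scaling factor
    [kappa], which is 2 in the real case and 1 in the imaginary case. *)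
Definition has_centered_form (R : realType) (B : 'M[R]_2) (kappa d : R) :
    Prop :=
  forall w, enorm (B *m w) = Num.sqrt (kappa * centered_form d (w 0 0) (w 1 0)).

Lemma covering_radius_centered (R : realType) (B : 'M[R]_2) (kappa d : R) :
    has_centered_form B kappa d -> 0 < kappa -> 1 <= d ->
  covering_radius (lattice_of B)
  = Num.sqrt (kappa * ((d + 1) ^+ 2 / (16 * d))).
Proof.
move=> enormB kappa_gt0 d_ge1.
apply: covering_radius_lattice_of => [w|].
  have d0 : 0 < d by lra.
  have [m [n le]] := centered_form_covers (w 0 0) (w 1 0) d0.
  exists (\col_i if i == 0 then m else n).
  by rewrite enormB !mxE ler_wsqrtr // ler_wpM2l ?(ltW kappa_gt0).
have [x [y hole]] := centered_form_hole d_ge1.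
exists (\col_i if i == 0 then x else y) => z.
by rewrite enormB !mxE ler_wsqrtr // ler_wpM2l ?(ltW kappa_gt0).
Qed.

(** The form is positive definite, so that [B] is injective. *)
Lemma rank_centered (R : realType) (B : 'M[R]_2) (kappa d : R) :
  has_centered_form B kappa d -> 0 < kappa -> 0 < d -> \rank B = 2.
Proof.
move=> enormB kappa_gt0 d_gt0.
apply/eqP; rewrite -mxrank_tr -/(row_free B^T) -kermx_eq0; apply/rowV0P => w.
move=> /sub_kermxP/(congr1 trmx); rewrite trmx_mul trmxK trmx0 => Bw0.
have : enorm (B *m w^T) = 0.
  by rewrite Bw0 -(scale0r 0) enormZ normr0 mul0r.
rewrite enormB => /eqP; rewrite sqrtr_eq0 pmulr_rle0 // !mxE /centered_form.
move=> Qle0.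
have w1 : w 0 1 = 0.
  apply/eqP; rewrite -sqrf_eq0 eq_le sqr_ge0 andbT.
  rewrite -(pmulr_rle0 _ d_gt0).
  by have := sqr_ge0 (w 0 0 + w 0 1 / 2); move: Qle0; lra.
have w0 : w 0 0 = 0.
  apply/eqP; rewrite -sqrf_eq0 eq_le sqr_ge0 andbT.
  by move: Qle0; rewrite w1; lra.
apply/rowP => i; rewrite mxE; have [->|] := eqVneq i 0; first by rewrite w0.
by case: i => -[|[|//]] // ilt _; rewrite -w1; congr (w _ _); exact: val_inj.
Qed.

(** * The ring of integers of a quadratic field *)

Lemma integral_intr_rmorph (A B : comNzRingType) (f : {rmorphism A -> B}) x :
  integralOver (intr : int -> A) x -> integralOver (intr : int -> B) (f x).
Proof.
move=> /(integral_rmorph f)[p pmonic px]; exists p => //.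
by rewrite (eq_map_poly (g := f \o intr)) // => a /=; rewrite rmorph_int.
Qed.

(** Z is integrally closed. The embedding [ratr] of the rationals transports the
    polynomial equation from [F] to the algebraic numbers, where this is the
    fact that a rational algebraic integer is an integer. *)
Lemma integral_ratr_int (F : numFieldType) (q : rat) :
  integralOver (intr : int -> F) (ratr q) -> q \is a Num.int.
Proof.
move=> [p pmonic]; rewrite (eq_map_poly (g := ratr \o intr)); last first.
  by move=> a /=; rewrite ratr_int.
rewrite map_poly_comp fmorph_root => pq.
rewrite -Cint_rat; apply: Cint_rat_Aint; first exact: Crat_rat.
apply: (@root_monic_Aint (map_poly intr p)).
- rewrite (eq_map_poly (g := ratr \o intr)); last first.
    by move=> a /=; rewrite ratr_int.
  by rewrite map_poly_comp fmorph_root.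
- by rewrite monic_map.
- by apply/polyOverP => i; rewrite coef_map /= intr_int.
Qed.

(** If q = u / v in lowest terms, then v ^ 2 divides D u ^ 2, hence D. *)
Lemma squarefree_int_sqr (D : int) (q : rat) :
  squarefree_int D -> D%:~R * q ^+ 2 \is a Num.int -> q \is a Num.int.
Proof.
move=> Dsqfree /intrP[M].
have v0 : ((denq q)%:~R : rat) != 0 by rewrite intr_eq0 denq_neq0.
rewrite -{1}(divq_num_den q) => /(congr1 ( *%R^~ ((denq q)%:~R ^+ 2))).
rewrite -mulrA expr_div_n divfK ?expf_neq0 // -!rmorphXn -!rmorphM /=.
move=> /eqP; rewrite eqr_int => /eqP eqD.
have : (denq q ^+ 2 %| D)%Z.
  rewrite -(@Gauss_dvdzr _ (numq q ^+ 2)).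
    by rewrite mulrC eqD dvdz_mull.
  rewrite coprimezXl // coprimezXr // coprimez_sym /coprimez.
  exact: coprime_num_den.
move=> /Dsqfree denu; apply/intrP; exists (numq q).
rewrite -{1}(divq_num_den q); suff -> : denq q = 1 by rewrite divr1.
by move: denu (denq_gt0 q) => /orP[] /eqP ->.
Qed.

Lemma Qsqrt_coords (K : fieldExtType rat) (s : K) (D : int) (x : K) :
  is_Qsqrt D s -> exists a b : rat, x = a%:A + b *: s.
Proof.
move=> [s2 Ks]; have /Fadjoin_polyP[p /polyOverP pQ ->] : x \in <<1%VS; s>>%VS.
  by rewrite Ks memvf.
pose inQs y := exists a b : rat, y = a%:A + b *: s.
have inQsD y z : inQs y -> inQs z -> inQs (y + z).
  move=> [a [b ->]] [c [e ->]]; exists (a + c), (b + e).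
  by rewrite !scalerDl addrACA.
have inQsZ k y : inQs y -> inQs (k *: y).
  move=> [a [b ->]]; exists (k * a), (k * b).
  by rewrite scalerDr !scalerA.
have inQsM y : inQs y -> inQs (y * s).
  move=> [a [b ->]]; exists (b * D%:~R), a.
  rewrite mulrDl -!scalerAl mul1r -expr2 s2 -scalerA addrC; congr (_ *: _ + _).
  by rewrite scaler_int.
rewrite horner_coef; apply: (big_ind inQs) => [||i _].
- by exists 0, 0; rewrite !scale0r addr0.
- exact: inQsD.
have /vlineP[k ->] := pQ i; rewrite -scalerAl mul1r; apply: inQsZ.
elim: {i}(i : nat) => [|i IHi].
  by exists 1, 0; rewrite scale1r scale0r addr0.
by rewrite exprSr; apply: inQsM.
Qed.

(** For x = a + b sqrt D, the trace 2 a and the norm a ^ 2 - D b ^ 2 are the sum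
    and the product of the two conjugates of x; they are integral and rational,
    hence integers. So D (2 b) ^ 2 is an integer, and so is 2 b because D is
    squarefree. With P = 2 a and Q = 2 b, the norm gives P ^ 2 = D Q ^ 2 mod 4
    and D = 1 mod 4 gives P = Q mod 2, whence x = (P - Q) / 2 + Q omega. *)
Lemma integers_of_quadratic (F : numFieldType) (D : int) (K : fieldExtType rat)
    (s : K) (sigma1 sigma2 : {rmorphism K -> F}) (x : K) :
    squarefree_int D -> (D = 1 %[mod 4])%Z -> is_Qsqrt D s ->
    sigma2 s = - sigma1 s ->
  integers_of x <-> exists m n : int, x = m%:~R + n%:~R * (2^-1 *: (1 + s)).
Proof.
move=> Dsqfree Dmod4 KQ sigmaN.
have [e D4] : exists e : int, D = 1 + 4 * e.
  by exists (D %/ 4)%Z; rewrite {1}(divz_eq D 4) Dmod4 addrC mulrC.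
have [s2 _] := KQ; split; last first.
  move=> [m [n ->]]; apply: integral_add; first exact: integral_id.
  apply: integral_mul; first exact: integral_id.
  (* omega ^ 2 = omega + (D - 1) / 4 *)
  exists ('X^2 - ('X + e%:P)).
    rewrite monicE lead_coefDl ?lead_coefXn //.
    by rewrite size_polyN size_XaddC size_polyXn.
  rewrite rootE rmorphB rmorphD /= map_polyXn map_polyX map_polyC /= !hornerE.
  have -> : (2^-1 *: (1 + s)) ^+ 2 = (4^-1 : rat) *: (1 + s) ^+ 2.
    by rewrite exprZn; congr (_ *: _).
  have -> : (1 + s) ^+ 2 = (2 : rat) *: (1 + s) + (4 : rat) *: e%:~R.
    have -> : (1 + s) ^+ 2 = 1 + 2 * s + D%:~R by rewrite -s2; ring.
    by rewrite D4 rmorphD rmorphM /= !scaler_nat; ring.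
  by rewrite scalerDr !scalerA (_ : 4^-1 * 2 = 2^-1) // mulVf // scale1r subrr.
have [a [b ->]] := Qsqrt_coords x KQ => xint.
have s12 : sigma1 s ^+ 2 = ratr D%:~R.
  by rewrite -rmorphXn s2 ratr_int rmorph_int.
have sigma1x : sigma1 (a%:A + b *: s) = ratr a + ratr b * sigma1 s.
  by rewrite rmorphD !rmorphZ_num rmorph1 mulr1.
have sigma2x : sigma2 (a%:A + b *: s) = ratr a - ratr b * sigma1 s.
  by rewrite rmorphD !rmorphZ_num rmorph1 mulr1 sigmaN mulrN.
have x1 := integral_intr_rmorph sigma1 xint.
have x2 := integral_intr_rmorph sigma2 xint.
have /intrP[P trP] : 2 * a \is a Num.int.
  apply: (@integral_ratr_int F).
  have -> : ratr (2 * a) = sigma1 (a%:A + b *: s) + sigma2 (a%:A + b *: s).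
    by rewrite sigma1x sigma2x rmorphM /= ratr_nat; ring.
  exact: integral_add.
have /intrP[N nmN] : a ^+ 2 - D%:~R * b ^+ 2 \is a Num.int.
  apply: (@integral_ratr_int F).
  have -> : ratr (a ^+ 2 - D%:~R * b ^+ 2)
      = sigma1 (a%:A + b *: s) * sigma2 (a%:A + b *: s).
    by rewrite sigma1x sigma2x rmorphB rmorphM !rmorphXn /= -s12; ring.
  exact: integral_mul.
have /intrP[Q bQ] : 2 * b \is a Num.int.
  apply: (squarefree_int_sqr Dsqfree); apply/intrP; exists (P ^+ 2 - 4 * N).
  by rewrite intrB !intrM -trP -nmN; ring.
have PQ : P ^+ 2 - D * Q ^+ 2 = 4 * N.
  apply/eqP; rewrite -(eqr_int rat) intrB !intrM.
  by rewrite -trP -bQ -nmN; apply/eqP; ring.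
have [t [Pt|Pt]] : exists t, P = 2 * t + Q \/ P = 2 * t + 1 + Q.
    by exists ((P - Q) %/ 2)%Z; lia.
  exists t, Q.
  have -> : a = t%:~R + Q%:~R / 2.
    by apply: (mulfI (_ : 2 != 0)) => //; rewrite trP Pt intrD intrM; field.
  have -> : b = Q%:~R / 2 by rewrite -bQ; field.
  have intrZ (n : int) (v : K) : n%:~R * v = (n%:~R : rat) *: v.
    by rewrite scaler_int mulrzl.
  by rewrite intrZ scalerA scalerDr scalerDl -(intrZ _ 1) mulr1 addrA.
by move: PQ; rewrite Pt D4; nia.
Qed.

(** * The lattice of integers of a quadratic field *)

(** The columns are the Minkowski images of 1 and of omega. *)
Definition omega_basis (R : realType) (D : int) : 'M[R]_2 :=
  let s : R := Num.sqrt `|D|%:~R in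
  \matrix_(i, j)
    if 0 < D then
      if j == 0 then 1 else if i == 0 then (1 + s) / 2 else (1 - s) / 2
    else
      if j == 0 then (i == 0)%:R else if i == 0 then 2^-1 else s / 2.

Lemma omega_basis_centered_form (R : realType) (D : int) :
  has_centered_form (omega_basis R D) (if 0 < D then 2 else 1) `|D|%:~R.
Proof.
move=> w; rewrite /enorm sum_ord2 !mxE !sum_ord2 !mxE /=.
have /sqr_sqrtr : 0 <= `|D|%:~R :> R by rewrite ler0z.
set s := Num.sqrt _ => <-; congr Num.sqrt.
by case: ifP => _; rewrite /centered_form; field.
Qed.

Lemma Omega_lattice_of (R : realType) (D : int) (K : fieldExtType rat)
    (sqrtD : K) (sigma1 sigma2 : {rmorphism K -> R[i]}) :
    squarefree_int D -> (D = 1 %[mod 4])%Z -> is_Qsqrt D sqrtD ->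
    sigma1 sqrtD = csqrtz R D -> sigma2 sqrtD = - csqrtz R D ->
  Omega D sigma1 sigma2 = lattice_of (omega_basis R D).
Proof.
move=> Dsqfree Dmod4 KQ s1 s2.
have s21 : sigma2 sqrtD = - sigma1 sqrtD by rewrite s1 s2.
have half : ratr 2^-1 = (2^-1 : R)%:C.
  by rewrite [LHS]fmorphV [RHS]fmorphV /= ratr_nat rmorph_nat.
pose gen (m n : int) : K := m%:~R + n%:~R * (2^-1 *: (1 + sqrtD)).
have sigma_gen (sigma : {rmorphism K -> R[i]}) m n :
    sigma (gen m n) = (m%:~R + n%:~R / 2 : R)%:C
                      + (n%:~R / 2 : R)%:C * sigma sqrtD.
  rewrite rmorphD rmorphM !rmorph_int rmorphZ_num rmorphD rmorph1.
  rewrite [(_ + _)%:C]rmorphD !rmorphM !rmorph_int half /=.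
  by ring.
have minkowski_gen m n : minkowski D sigma1 sigma2 (gen m n)
    = omega_basis R D *m map_mx intr (\col_i if i == 0 then m else n).
  rewrite /minkowski !sigma_gen s2 s1 /csqrtz -complexiE /omega_basis.
  case D0: (0 < D); apply/colP => i; rewrite !mxE sum_ord2 !mxE /= ?D0 /=.
    by rewrite gtr0_norm //; case: (i == 0) => /=; field.
  by case: (i == 0) => /=; field.
apply/seteqP; split => [_ [x xint <-]|_ [z _ <-]].
  have [m [n ->]] := (integers_of_quadratic x Dsqfree Dmod4 KQ s21).1 xint.
  by rewrite minkowski_gen; exists (\col_i if i == 0 then m else n).
exists (gen (z 0 0) (z 1 0)).
  apply/(integers_of_quadratic _ Dsqfree Dmod4 KQ s21).
  by exists (z 0 0), (z 1 0).
rewrite minkowski_gen; congr (_ *m map_mx _ _); apply/colP => i; rewrite mxE.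
have [->//|] := eqVneq i 0.
by case: i => -[|[|//]] // ilt _; congr (z _ _); exact: val_inj.
Qed.

(** An integer point would satisfy d ((2 m + n) ^ 2 + d n ^ 2) = (d + 1) ^ 2 in
    the integers, which is absurd modulo d. The factor 4 is there because the
    covering radius of a rank-one lattice is half the length of its
    generator. *)
Lemma centered_form_neq_hole (R : realType) (d m n : int) : 1 < d ->
  centered_form (d%:~R : R) m%:~R n%:~R
  <> 4 * ((d%:~R + 1) ^+ 2 / (16 * d%:~R)).
Proof.
move=> d1 eqQ; have d0 : (d%:~R : R) != 0 by rewrite intr_eq0; lia.
have eqd : d * ((2 * m + n) ^+ 2 + d * n ^+ 2) = (d + 1) ^+ 2.
  apply/eqP; rewrite -(eqr_int R) !(intrD, intrM).
  apply/eqP; transitivity (4 * d%:~R * centered_form d%:~R m%:~R n%:~R : R).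
    by rewrite /centered_form; field.
  by rewrite eqQ; field.
have : (d %| 1)%Z.
  apply/dvdzP; exists ((2 * m + n) ^+ 2 + d * n ^+ 2 - (d + 2)).
  by rewrite mulrBl [_ * d]mulrC eqd; ring.
by rewrite dvdz1; lia.
Qed.

Theorem corollary5p5 (R : realType) (D : int)
    (Dsqfree : squarefree_int D)
    (Dmod4 : (D = 1 %[mod 4])%Z)
    (Dneq1 : D <> 1)
    (K : fieldExtType rat) (sqrtD : K)
    (KQsqrtD : is_Qsqrt D sqrtD)
    (sigma1 sigma2 : {rmorphism K -> R[i]})
    (sigma1D : sigma1 sqrtD = csqrtz R D)
    (sigma2D : sigma2 sqrtD = - csqrtz R D) :
  is_lattice_of_rank 2 (Omega D sigma1 sigma2) /\
  forall L : set 'cV[R]_2,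
    is_lattice_of_rank 1 L ->
    ~ equal_covering_extension L (Omega D sigma1 sigma2).
Proof.
have norm_gt1 : 1 < `|D| by lia.
have d_gt1 : 1 < `|D|%:~R :> R by rewrite ltr1z.
have quadB := @omega_basis_centered_form R D.
set kappa : R := if 0 < D then 2 else 1 in quadB.
have kappa_gt0 : 0 < kappa by rewrite /kappa; case: ifP.
rewrite (Omega_lattice_of Dsqfree Dmod4 KQsqrtD sigma1D sigma2D).
split.
  by exists (omega_basis R D); split => //; apply: rank_centered quadB _ _; lra.
move=> _ [b [_ ->]] [_ [/(_ b) sub _]].
rewrite -/(lattice_of b) covering_radius_rank1.
rewrite (covering_radius_centered quadB) ?(ltW d_gt1) //.
have /sub[z _ <-] : lattice_of b b.
  by exists 1%:M => //; rewrite map_mx1 mulmx1.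
rewrite quadB !mxE => eqmu.
apply: (@centered_form_neq_hole R `|D| (z 0 0) (z 1 0)) => //.
have Q0 x y : 0 <= centered_form (`|D|%:~R : R) x y.
  rewrite /centered_form addr_ge0 ?sqr_ge0 // divr_ge0 //.
  by rewrite mulr_ge0 ?sqr_ge0 //; lra.
have rho0 : 0 <= (`|D|%:~R + 1 : R) ^+ 2 / (16 * `|D|%:~R).
  by rewrite divr_ge0 ?sqr_ge0 // mulr_ge0 //; lra.
apply: (mulfI (lt0r_neq0 kappa_gt0)).
rewrite -[LHS]sqr_sqrtr; last by rewrite mulr_ge0 // ltW.
rewrite mulrCA -[X in _ = 4 * X]sqr_sqrtr; last by rewrite mulr_ge0 // ltW.
by rewrite eqmu; field.
Qed.
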